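(* The following statements hold: (i) If $N-1\ge2\phi(N)$, then the system $\mathcal R_{1,N}$ is robust to 2 erasures. (ii) If $N=2d$ with $d$ odd and $d-1\ge2\phi(N)$, then the system $\mathcal R_{2,N}$ is robust to 2 erasures.
   Context: $\ell^2(\mathbb Z_N)$ is the $N$-dimensional complex Hilbert space of functions on $\mathbb Z_N=\{0,1,\dots,N-1\}$ (identified with $N$-periodic functions on $\mathbb Z$), with $\langle x,y\rangle=\sum_{n=0}^{N-1}x(n)\overline{y(n)}$. For $m\in\mathbb Z$, the circular shift is $L_mx(n)=x(n-m)$. For a positive integer $q$, the $q$-th Ramanujan sum is $c_q(n)=\sum_{1\le k\le q,\,(k,q)=1}e^{2\pi i kn/q}$; it is $q$-periodic, so for $q\mid N$ it is regarded as an element of $\ell^2(\mathbb Z_N)$. $\phi$ is Euler's totient function. For $N=pd$ ($p,d$ positive integers) with positive divisors $q_1,\dots,q_K$, $\mathcal R_{p,N}$ denotes the family $(L_{pk}c_{q_i})$ indexed by $(k,i)\in\{0,\dots,d-1\}\times\{1,\dots,K\}$. A finite family $(f_j)$ in a finite-dimensional Hilbert space $H$ is a frame for $H$ if there are constants $A,B>0$ with $A\|x\|^2\le\sum_j|\langle x,f_j\rangle|^2\le B\|x\|^2$ for all $x\in H$. The family $\mathcal R_{p,N}$ is robust to $e$ erasures if, for every set $\mathcal I$ of $e$ indices $(k,i)$, the family obtained by deleting the members with index in $\mathcal I$ is still a frame for $\ell^2(\mathbb Z_N)$. *)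

(* Defs.v *)
From mathcomp Require Import all_boot all_order all_algebra.
From mathcomp Require Import complex.
From mathcomp Require Import reals trigo.

Set Implicit Arguments.
Unset Strict Implicit.
Unset Printing Implicit Defensive.

Import Order.TTheory GRing.Theory Num.Theory.

Local Open Scope complex_scope.
Local Open Scope ring_scope.

(* The integers modulo N are 'I_N rather than 'Z_N, because 'Z_1 has two
   elements. *)
Definition ell2 (R : realType) (N : nat) := {ffun 'I_N -> R[i]}.

Definition inner (R : realType) (N : nat) (x y : ell2 R N) : R[i] :=
  \sum_(n < N) x n * Num.conj (y n).

(* The representative in {0, .., N-1} of n - m modulo N; 'I_N being inhabited
   by n, N is positive. *)
Fact sub_mod_subproof (N : nat) (n : 'I_N) (m : int) :
  (`|((n : nat)%:Z - m) %% N%:Z|%Z < N)%N.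
Proof.
have N0 : (0 < N)%N by apply: leq_ltn_trans (ltn_ord n).
have N0' : N%:Z != 0 by rewrite eqz_nat -lt0n.
by rewrite -ltz_nat gez0_abs ?modz_ge0 // ltz_pmod.
Qed.

Definition sub_mod (N : nat) (n : 'I_N) (m : int) : 'I_N :=
  Ordinal (sub_mod_subproof n m).

Definition shift (R : realType) (N : nat) (m : int) (x : ell2 R N) : ell2 R N :=
  [ffun n => x (sub_mod n m)].

Definition cis (R : realType) (t : R) : R[i] := cos t +i* sin t.

Definition ramanujan_sum (R : realType) (q : nat) (n : int) : R[i] :=
  \sum_(1 <= k < q.+1 | coprime k q) cis (2 * pi * k%:R * n%:~R / q%:R : R).

Definition ramanujan_vec (R : realType) (N q : nat) : ell2 R N :=
  [ffun n : 'I_N => ramanujan_sum R q (n : nat)%:Z].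

(* Both sides of each inequality are real elements of R[i], on which the order
   of R[i] is that of R. *)
Definition is_frame (R : realType) (N : nat) (J : finType)
    (f : J -> ell2 R N) : Prop :=
  exists A B : R, [/\ 0 < A, 0 < B & forall x : ell2 R N,
    A%:C * inner x x <= \sum_(j : J) `|inner x (f j)| ^+ 2
                     <= B%:C * inner x x].

Definition robust_to_erasures (R : realType) (N : nat) (J : finType)
    (e : nat) (f : J -> ell2 R N) : Prop :=
  forall I : {set J}, #|I| = e ->
    is_frame (fun j : {j : J | j \notin I} => f (val j)).

(* Meant for 0 < N and p dividing N, so that N %/ p is the d with N = p d;
   q_1, .., q_K is the increasing list of all positive divisors of N. *)
Definition ramanujan_system (R : realType) (p N : nat)
    (ki : 'I_(N %/ p) * 'I_(size (divisors N))) : ell2 R N :=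
  shift (p * ki.1)%N%:Z (ramanujan_vec R N (nth 0%N (divisors N) ki.2)).

Arguments ramanujan_system : clear implicits.

(* Main.v *)
(* On Z_N, c_q is the sum of the characters of frequency j with
   gcd(j, N) = N / q, and these sets of j partition the frequencies. The
   coefficients of x against the shifts L_{pk} c_q are thus the values at
   0 <= k < d of a trigonometric sum with totient q <= totient N frequencies.
   These stay distinct modulo d = N / p: this is clear for p = 1, and for p = 2
   with d odd it holds because gcd(j, N) determines the parity of j. By Parseval
   the squares of the d values add up to d times the squared norm of the Fourier
   coefficients, and by Cauchy-Schwarz each of them is at most totient N times
   this squared norm. Hence if e * totient N < d, deleting e values leaves at
   least the squared norm, and summing over q gives the explicit frame bounds
   N and d N. *)

Require Import Defs.
From mathcomp Require Import all_boot all_order all_algebra.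
From mathcomp Require Import complex.
From mathcomp Require Import reals trigo.
From mathcomp Require Import ring zify.

Set Implicit Arguments.
Unset Strict Implicit.
Unset Printing Implicit Defensive.

Import Order.TTheory GRing.Theory Num.Theory.

Local Open Scope ring_scope.

(** * Totients and the gcd classes of frequencies *)

(** In the product formula, the primes of [m] occur in [n] with at least the same exponent, and the
    factors of [n] at other primes are positive. Thus [totient N] bounds the number of frequencies
    of every divisor. *)
Lemma leq_totient_dvd (m n : nat) :
  (0 < n)%N -> (m %| n)%N -> (totient m <= totient n)%N.
Proof.
move=> n_gt0 m_dv_n; have m_gt0 := dvdn_gt0 n_gt0 m_dv_n.
rewrite !totientE //.
have sub_mn p : p \in primes m -> p \in primes n.
  rewrite !mem_primes n_gt0 m_gt0 /= => /andP[-> /dvdn_trans-> //].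
rewrite [X in (_ <= X)%N](bigID (mem (primes m))) /=.
have -> F : (\prod_(p <- primes n | p \in primes m) F p =
             \prod_(p <- primes m) F p)%N.
  rewrite -big_filter; apply: perm_big; apply: uniq_perm => [||p].
  - by rewrite filter_uniq // primes_uniq.
  - exact: primes_uniq.
  by rewrite mem_filter; apply/andP/idP => [[]|pm] //; split=> //; apply: sub_mn.
apply: leq_trans (leq_pmulr _ _).
  rewrite big_seq_cond [X in (_ <= X)%N]big_seq_cond.
  apply: (big_ind2 (fun a b => a <= b)%N) => // [????|p]; first exact: leq_mul.
  rewrite andbT mem_primes => /andP[p_pr _].
  rewrite leq_mul2l leq_pexp2l ?prime_gt0 ?orbT //.
  by rewrite -!subn1 leq_sub2r // dvdn_leq_log.
rewrite big_seq_cond prodn_cond_gt0 // => p /andP[].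
rewrite mem_primes => /andP[p_pr _] _.
by rewrite muln_gt0 expn_gt0 (prime_gt0 p_pr) -ltnS prednK ?prime_gt0 ?prime_gt1.
Qed.

(* Frequency 0 is represented by N, as in the range 1 <= k <= q of c_q. *)
Definition frequencies (N q : nat) : seq nat :=
  [seq j <- index_iota 1 N.+1 | gcdn j N == (N %/ q)%N].

(** With [N = r * q], the identity gcd(r k, r q) = r gcd(k, q) makes multiplication by [r] a
    bijection between the two index sets. *)
Lemma frequencies_perm (N q : nat) : (0 < N)%N -> (q %| N)%N ->
  perm_eq [seq (N %/ q * k)%N | k <- index_iota 1 q.+1 & coprime k q]
          (frequencies N q).
Proof.
move=> N_gt0 q_dv_N; have q_gt0 := dvdn_gt0 N_gt0 q_dv_N.
have [r defN] := dvdnP q_dv_N.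
have r_gt0 : (0 < r)%N by move: N_gt0; rewrite defN muln_gt0 => /andP[].
rewrite /frequencies defN mulnK //.
apply: uniq_perm.
- rewrite map_inj_uniq ?filter_uniq ?iota_uniq // => k l.
  by move/eqP; rewrite eqn_pmul2l // => /eqP.
- by rewrite filter_uniq ?iota_uniq.
move=> j; rewrite mem_filter mem_index_iota; apply/mapP/andP.
  move=> [k]; rewrite mem_filter mem_index_iota.
  move=> /and3P[co_kq k_gt0 lekq ->]; rewrite -muln_gcdr (eqP co_kq) muln1.
  by rewrite ltnS muln_gt0 r_gt0 k_gt0 leq_mul2l -ltnS lekq orbT.
move=> [/eqP gj /andP[j_gt0 lej]].
have /dvdnP[k defj] : (r %| j)%N by rewrite -gj dvdn_gcdl.
move: gj j_gt0 lej; rewrite defj mulnC -muln_gcdr => /eqP.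
rewrite -[X in _ == X]muln1 eqn_pmul2l // muln_gt0 ltnS leq_pmul2l //.
move=> co_kq /andP[_ k_gt0] lekq.
by exists k; rewrite // mem_filter mem_index_iota k_gt0 ltnS lekq /coprime co_kq.
Qed.

Lemma size_frequencies (N q : nat) : (0 < N)%N -> (q %| N)%N ->
  size (frequencies N q) = totient q.
Proof.
move=> N_gt0 q_dv_N; have q_gt0 := dvdn_gt0 N_gt0 q_dv_N.
rewrite -(perm_size (frequencies_perm N_gt0 q_dv_N)) size_map size_filter.
rewrite totient_count_coprime -sum1_count big_mkcond /=.
(* One count runs over 1..q and the other over 0..q-1; the end terms [q] and 0 agree, as both have
   gcd [q] with [q]. *)
rewrite big_nat_recr //= [RHS]big_ltn // addnC; congr (_ + _)%N.
  by rewrite /coprime gcdnn gcdn0; case: (q == 1)%N.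
by apply: eq_bigr => k _; rewrite coprime_sym; case: coprime.
Qed.

(** Each [j] lies in the class of exactly one divisor, namely [N %/ gcdn j N]. *)
Lemma big_frequencies (V : nmodType) (N : nat) (F : nat -> V) : (0 < N)%N ->
  \sum_(q <- divisors N) \sum_(j <- frequencies N q) F j =
  \sum_(1 <= j < N.+1) F j.
Proof.
move=> N_gt0; under eq_bigr do rewrite big_filter big_mkcond.
rewrite exchange_big /= big_seq [RHS]big_seq; apply: eq_bigr => j.
rewrite mem_index_iota => /andP[j_gt0 _].
have g_dv : (gcdn j N %| N)%N by apply: dvdn_gcdr.
have g_gt0 : (0 < gcdn j N)%N by rewrite gcdn_gt0 j_gt0.
rewrite -big_mkcond /= (big_rem (N %/ gcdn j N)%N) /=; last first.
  by rewrite -dvdn_divisors // dvdn_div.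
rewrite divnA // mulKn // eqxx big_seq_cond big_pred0 ?addr0 // => q.
rewrite (mem_rem_uniq _ (divisors_uniq N)) inE /= -dvdn_divisors //.
apply/negP => /andP[/andP[q_neq q_dv] /eqP gE].
by case/eqP: q_neq; rewrite gE divnA // mulKn.
Qed.

(** * Sampled sums of roots of unity *)

Section FiniteFourier.
Variable C : numClosedFieldType.

(** Cauchy-Schwarz against the constant family 1: the square of the sum of norms is a double sum of
    products, each at most the mean of the two squares. *)
Lemma sqr_norm_sum_le (I : Type) (s : seq I) (b : I -> C) :
  `|\sum_(i <- s) b i| ^+ 2 <= (size s)%:R * \sum_(i <- s) `|b i| ^+ 2.
Proof.
set S := \sum_(i <- s) `|b i|.
have le_S : `|\sum_(i <- s) b i| <= S by apply: ler_norm_sum.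
have S_ge0 : 0 <= S by apply: sumr_ge0.
apply: (@le_trans _ _ (S ^+ 2)); first by rewrite ler_pXn2r ?nnegrE.
set T := \sum_(i <- s) `|b i| ^+ 2.
have -> : (size s)%:R * T =
    \sum_(i <- s) \sum_(j <- s) (`|b i| ^+ 2 + `|b j| ^+ 2) / 2.
  under eq_bigr do
    rewrite -mulr_suml big_split /= big_const_seq count_predT iter_addr_0.
  rewrite -mulr_suml big_split /= sumrMnl.
  rewrite big_const_seq count_predT iter_addr_0.
  by rewrite -mulr2n -[_ *+ 2]mulr_natr mulfK ?pnatr_eq0 // mulr_natl.
rewrite expr2 mulr_suml; apply: ler_sum => i _; rewrite mulr_sumr.
apply: ler_sum => j _.
rewrite ler_pdivlMr ?ltr0n // -subr_ge0.
suff -> : `|b i| ^+ 2 + `|b j| ^+ 2 - `|b i| * `|b j| * 2 =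
    (`|b i| - `|b j|) ^+ 2.
  by rewrite real_exprn_even_ge0 // rpredB // normr_real.
by rewrite sqrrB mulr_natr addrAC.
Qed.

(** The sequences of powers of distinct [d]-th roots of unity are orthogonal over one period, each
    with squared norm [d]. *)
Lemma parseval (I : eqType) (s : seq I) (d : nat) (z a : I -> C) :
  (0 < d)%N -> uniq s -> {in s &, injective z} ->
  {in s, forall i, z i ^+ d = 1} ->
  \sum_(k < d) `|\sum_(i <- s) a i * z i ^+ k| ^+ 2 =
  d%:R * \sum_(i <- s) `|a i| ^+ 2.
Proof.
move=> d_gt0 s_uniq z_inj zd1.
have z_norm i : i \in s -> z i * Num.conj (z i) = 1.
  move=> si; rewrite -normCK; suff -> : `|z i| = 1 by rewrite expr1n.
  by apply/eqP; rewrite -(pexpr_eq1 d_gt0) // -normrX zd1 // normr1.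
transitivity (\sum_(i <- s) \sum_(j <- s) a i * Num.conj (a j) *
    \sum_(k < d) (z i * Num.conj (z j)) ^+ k).
  under eq_bigr => k _.
    rewrite normCK rmorph_sum mulr_suml.
    under eq_bigr do rewrite mulr_sumr.
    over.
  rewrite exchange_big; apply: eq_bigr => i _; rewrite exchange_big.
  apply: eq_bigr => j _; rewrite mulr_sumr; apply: eq_bigr => k _.
  by rewrite rmorphM rmorphXn exprMn mulrACA.
rewrite mulr_sumr big_seq [RHS]big_seq; apply: eq_bigr => i si.
rewrite (bigD1_seq i) //= z_norm //.
under eq_bigr do rewrite expr1n.
rewrite sumr_const card_ord -normCK mulrC big_seq_cond.
rewrite [X in _ + X]big1 ?addr0 // => j /andP[sj ji].
set u := z i * _.
have u_neq1 : u - 1 != 0.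
  apply: contra ji => /eqP/subr0_eq u1; apply/eqP/z_inj => //.
  by rewrite -[z i]mulr1 -(z_norm j sj) mulrCA mulrA -mulrA -/u u1 mulr1.
(* The geometric sum vanishes: its product with the nonzero [u - 1] is [u ^+ d - 1], which is 0. *)
apply/eqP; rewrite mulf_eq0 -[X in _ || X](mulrI_eq0 _ (mulfI u_neq1)) -subrX1.
by rewrite exprMn -rmorphXn !zd1 // rmorph1 mulr1 subrr eqxx orbT.
Qed.

(** [P] selects the samples that are kept. The upper bound only discards nonnegative terms from
    [parseval]; the lower one subtracts the largest possible loss. *)
Lemma erasure_bounds (I : eqType) (s : seq I) (d e : nat) (z a : I -> C)
    (P : pred 'I_d) :
  (0 < d)%N -> uniq s -> {in s &, injective z} ->
  {in s, forall i, z i ^+ d = 1} ->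
  (#|[pred k | ~~ P k]| <= e)%N -> (e * size s < d)%N ->
  \sum_(i <- s) `|a i| ^+ 2 <=
    \sum_(k < d | P k) `|\sum_(i <- s) a i * z i ^+ k| ^+ 2
  <= d%:R * \sum_(i <- s) `|a i| ^+ 2.
Proof.
move=> d_gt0 s_uniq z_inj zd1 cardP lt_es.
set T := \sum_(i <- s) `|a i| ^+ 2.
pose g (k : 'I_d) := `|\sum_(i <- s) a i * z i ^+ k| ^+ 2.
have eqT : \sum_(k < d) g k = d%:R * T := parseval a d_gt0 s_uniq z_inj zd1.
rewrite -[\sum_(k < d | P k) _]/(\sum_(k < d | P k) g k).
have T_ge0 : 0 <= T by apply: sumr_ge0 => i _; rewrite exprn_ge0.
have g_ge0 k : 0 <= g k by rewrite exprn_ge0.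
have z_norm i : i \in s -> `|z i| = 1.
  by move=> si; apply/eqP; rewrite -(pexpr_eq1 d_gt0) // -normrX zd1 // normr1.
have g_le k : g k <= (size s)%:R * T.
  apply: le_trans (sqr_norm_sum_le _ _) _.
  rewrite ler_wpM2l ?ler0n // big_seq [leRHS]big_seq.
  by apply: ler_sum => i si; rewrite normrM normrX z_norm // expr1n mulr1.
rewrite (bigID P) /= in eqT; apply/andP; split.
  have le_er : \sum_(k < d | ~~ P k) g k <= (e * size s)%:R * T.
    apply: le_trans (ler_sum _ (fun k _ => g_le k)) _.
    rewrite sumr_const -[leLHS]mulr_natl mulrA -natrM ler_wpM2r // ler_nat.
    by rewrite leq_mul2r cardP orbT.
  rewrite -(lerD2r (\sum_(k < d | ~~ P k) g k)) eqT.
  apply: le_trans (lerD (lexx _) le_er) _.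
  (* Between integers, [e * size s < d] leaves room for one whole [T], whence the lower constant
     1. *)
  by rewrite -[X in X + _]mul1r -mulrDl -mulrS ler_wpM2r // ler_nat.
by rewrite -eqT lerDl sumr_ge0.
Qed.

End FiniteFourier.

(** * Fourier analysis of the Ramanujan system *)

Section Ramanujan.
Variable R : realType.
Implicit Types (N q : nat).

Lemma cisD (s t : R) : cis (s + t) = cis s * cis t.
Proof. by rewrite /cis cosD sinD [sin s * _ + _]addrC; simpc. Qed.

Lemma cis0 : cis (0 : R) = 1.
Proof. by rewrite /cis cos0 sin0. Qed.

Lemma cisX (t : R) n : cis t ^+ n = cis (n%:R * t).
Proof.
elim: n => [|n IHn]; first by rewrite mul0r cis0.
by rewrite exprS IHn -cisD -addn1 natrD mulrDl mul1r addrC.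
Qed.

Definition root_of_unity N : R[i] := cis (2 * pi / N%:R).

Lemma root_of_unityX N n : root_of_unity N ^+ n = cis (2 * pi * n%:R / N%:R).
Proof. by rewrite cisX mulrC mulrAC. Qed.

(** For an exponent [m] strictly between 0 and [N], put t = pi m / N. A power equal to 1 would give
    cos(2t) = 1, hence sin t = 0, although 0 < t < pi. *)
Lemma root_of_unity_prim N : (0 < N)%N -> N.-primitive_root (root_of_unity N).
Proof.
move=> N_gt0; rewrite /primitive_root_of_unity N_gt0 /=.
apply/forallP => i; rewrite unity_rootE; apply/eqP.
have N_neq0 : N%:R != 0 :> R by rewrite pnatr_eq0 -lt0n.
rewrite root_of_unityX; case: (eqVneq i.+1 N) => [->|i_neq].
  by rewrite mulfK // mulr_natl /cis cos2pi sin2pi eqxx.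
have ltiN : (i.+1 < N)%N by rewrite ltn_neqAle i_neq ltn_ord.
set t := pi * i.+1%:R / N%:R : R.
have -> : 2 * pi * i.+1%:R / N%:R = t *+ 2 by rewrite -[RHS]mulr_natl /t !mulrA.
have sin_gt0 : 0 < sin t.
  apply: sin_gt0_pi; rewrite /t -mulrA.
  have pi0 := pi_gt0 R.
  rewrite !mulr_gt0 ?invr_gt0 ?ltr0n //= -[ltRHS]mulr1 ltr_pM2l //.
  by rewrite ltr_pdivrMr ?ltr0n // mul1r ltr_nat.
apply/negP; rewrite eq_complex /= cos_mulr2n cos2sin2 => /andP[/eqP h _].
move: h; rewrite mulrnBl [1 *+ 2]mulr2n addrAC addrK => /eqP.
rewrite -subr_eq0 addrAC subrr add0r oppr_eq0 mulrn_eq0 /= expf_eq0 /=.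
by rewrite gt_eqF.
Qed.

Lemma sub_modE N (n : 'I_N) (m : nat) : (sub_mod n m%:Z + m = n %[mod N])%N.
Proof.
have N_neq0 : N%:Z != 0 by rewrite eqz_nat -lt0n; apply: leq_ltn_trans (ltn_ord n).
apply/eqP; rewrite -eqz_nat -!modz_nat PoszD /= gez0_abs ?modz_ge0 //.
by rewrite modzDml subrK.
Qed.

(** The unnormalised discrete Fourier transform; [j] is any natural number, so that [N] can stand
    for frequency 0. *)
Definition fourier N (x : ell2 R N) (j : nat) : R[i] :=
  \sum_(n < N) x n * Num.conj (root_of_unity N ^+ (j * n)).

Lemma conj_root_of_unity N : (0 < N)%N ->
  Num.conj (root_of_unity N) = (root_of_unity N)^-1.
Proof.
move=> N_gt0; have wN := prim_expr_order (root_of_unity_prim N_gt0).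
have w1 : `|root_of_unity N| = 1.
  by apply/eqP; rewrite -(pexpr_eq1 N_gt0) // -normrX wN normr1.
by rewrite invC_norm w1 expr1n invr1 mul1r.
Qed.

(** This is [parseval] with the points [n] indexing the roots and the frequencies [j] as exponents,
    after frequency [N] is replaced by 0. *)
Lemma fourier_parseval N (x : ell2 R N) : (0 < N)%N ->
  \sum_(1 <= j < N.+1) `|fourier x j| ^+ 2 = N%:R * inner x x.
Proof.
move=> N_gt0; have prim := root_of_unity_prim N_gt0.
have wN := prim_expr_order prim.
have fourierN : fourier x N = fourier x 0.
  by apply: eq_bigr => n _; rewrite exprM wN expr1n mul0n.
rewrite big_nat_recr //= fourierN addrC -(big_ltn N_gt0) big_mkord.
under eq_bigr => j _.
  rewrite (_ : fourier x j =
      \sum_(n < N) x n * (Num.conj (root_of_unity N ^+ n)) ^+ j).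
    over.
  by apply: eq_bigr => n _; rewrite mulnC exprM -rmorphXn.
rewrite parseval ?index_enum_uniq //.
- by congr (_ * _); apply: eq_bigr => n _; rewrite normCK.
- move=> m n _ _ /(can_inj (@conjCK _))/eqP.
  rewrite (eq_prim_root_expr prim) !modn_small // => /eqP.
  exact: val_inj.
by move=> n _; rewrite -rmorphXn -exprM mulnC exprM wN expr1n rmorph1.
Qed.

Lemma ramanujan_sumE N q (n : nat) : (0 < N)%N -> (q %| N)%N ->
  ramanujan_sum R q n%:Z =
  \sum_(j <- frequencies N q) root_of_unity N ^+ (j * n).
Proof.
move=> N_gt0 q_dv_N; have q_gt0 := dvdn_gt0 N_gt0 q_dv_N.
rewrite -(perm_big _ (frequencies_perm N_gt0 q_dv_N)) big_map big_filter.
apply: eq_bigr => k _; rewrite root_of_unityX; congr cis.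
have [r defN] := dvdnP q_dv_N.
have r_gt0 : (0 < r)%N by move: N_gt0; rewrite defN muln_gt0 => /andP[].
have r0 : r%:R != 0 :> R by rewrite pnatr_eq0 -lt0n.
have q0 : q%:R != 0 :> R by rewrite pnatr_eq0 -lt0n.
rewrite defN mulnK // !natrM -[n%:Z%:~R]/(n%:R).
by field; rewrite q0.
Qed.

(** Shifting by [m] multiplies the character of frequency [j] by a constant, whose conjugate is the
    power with exponent [j * m]. *)
Lemma inner_shift_ramanujan N q (m : nat) (x : ell2 R N) :
  (0 < N)%N -> (q %| N)%N ->
  inner x (shift m%:Z (ramanujan_vec R N q)) =
  \sum_(j <- frequencies N q) fourier x j * root_of_unity N ^+ (j * m).
Proof.
move=> N_gt0 q_dv_N; have prim := root_of_unity_prim N_gt0.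
under [RHS]eq_bigr do rewrite mulr_suml.
rewrite exchange_big; apply: eq_bigr => n _ /=.
rewrite /shift ffunE /ramanujan_vec ffunE (ramanujan_sumE _ N_gt0) //.
rewrite rmorph_sum mulr_sumr; apply: eq_bigr => j _.
rewrite -mulrA; congr (_ * _).
have w0 : root_of_unity N != 0.
  apply: contra_eq_neq (prim_expr_order prim) => ->.
  by rewrite expr0n gtn_eqF // eq_sym oner_neq0.
(* The wrap-around in [sub_mod] is invisible to the powers of an [N]-th root of unity. *)
have -> : root_of_unity N ^+ (j * n) =
    root_of_unity N ^+ (j * sub_mod n m%:Z) * root_of_unity N ^+ (j * m).
  rewrite -exprD -mulnDr; apply/eqP; rewrite (eq_prim_root_expr prim).
  by rewrite -modnMmr -(modnMmr _ (_ + _)) sub_modE.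
rewrite rmorphM /= -mulrA [Num.conj (_ ^+ (j * m))]rmorphXn /=.
rewrite conj_root_of_unity //.
by rewrite exprVn mulVf ?mulr1 // expf_neq0.
Qed.

(** Shifts by multiples of [p] replace the root of unity by its [p]-th power, of order [N %/ p]. The
    injectivity hypothesis keeps the roots within one gcd class distinct, as [parseval] requires. *)
Lemma ramanujan_system_robust (p N e : nat) : (0 < N)%N -> (p %| N)%N ->
  (forall j l, (0 < j <= N)%N -> (0 < l <= N)%N -> gcdn j N = gcdn l N ->
     j = l %[mod N %/ p] -> j = l) ->
  (e * totient N < N %/ p)%N ->
  robust_to_erasures e (ramanujan_system R p N).
Proof.
move=> N_gt0 p_dv_N inj_mod lt_e I cardI.
have prim := root_of_unity_prim N_gt0.
set d := (N %/ p)%N in inj_mod lt_e *.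
have d_gt0 : (0 < d)%N by apply: leq_ltn_trans lt_e.
have primd : d.-primitive_root (root_of_unity N ^+ p).
  have -> : p = (N %/ d)%N by rewrite /d divnA // mulKn.
  by rewrite dvdn_prim_root // dvdn_div.
(* The constants 1 and [d] of [erasure_bounds], times the factor [N] of [fourier_parseval]. *)
exists N%:R, (d%:R * N%:R); split; rewrite ?mulr_gt0 ?ltr0n // => x.
rewrite -(big_sub (fun j => j \notin I)
  (fun j => `|inner x (ramanujan_system R p N j)| ^+ 2)) /=.
rewrite rmorphM !rmorph_nat -mulrA -fourier_parseval //.
rewrite -(big_frequencies (fun j => `|fourier x j| ^+ 2)) //.
rewrite (big_nth 0%N) big_mkord.
rewrite (eq_big (fun j => (j.1, j.2) \notin I)
  (fun j => `|inner x (ramanujan_system R p N (j.1, j.2))| ^+ 2)) => [|[]|[]] //.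
rewrite -(pair_big_dep xpredT (fun k i => (k, i) \notin I)
  (fun k i => `|inner x (ramanujan_system R p N (k, i))| ^+ 2)) /=.
rewrite (exchange_big_dep xpredT) //= mulr_sumr.
(* The frequency classes partition 1..N, so it is enough to bound the contribution of each divisor
   separately. *)
suff bounds (i : 'I_(size (divisors N))) :
    \sum_(j <- frequencies N (nth 0%N (divisors N) i)) `|fourier x j| ^+ 2 <=
      \sum_(k < d | (k, i) \notin I)
        `|inner x (ramanujan_system R p N (k, i))| ^+ 2
    <= d%:R *
      \sum_(j <- frequencies N (nth 0%N (divisors N) i)) `|fourier x j| ^+ 2.
  by apply/andP; split; apply: ler_sum => i _; have /andP[] := bounds i.
set q := nth _ _ _.
have q_dv_N : (q %| N)%N by rewrite dvdn_divisors // mem_nth.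
have -> : \sum_(k < d | (k, i) \notin I)
      `|inner x (ramanujan_system R p N (k, i))| ^+ 2 =
    \sum_(k < d | (k, i) \notin I)
      `|\sum_(j <- frequencies N q)
          fourier x j * ((root_of_unity N ^+ p) ^+ j) ^+ k| ^+ 2.
  apply: eq_bigr => k _; rewrite inner_shift_ramanujan //; congr (`|_| ^+ _).
  by apply: eq_bigr => j _; rewrite -!exprM mulnCA mulnA.
apply: (erasure_bounds _ (e := e)) => //.
- by rewrite filter_uniq ?iota_uniq.
- move=> j l; rewrite !mem_filter !mem_index_iota !ltnS.
  move=> /andP[/eqP gj jN] /andP[/eqP gl lN] /eqP.
  rewrite (eq_prim_root_expr primd) => /eqP.
  by apply: inj_mod => //; rewrite gj gl.
- by move=> j _; rewrite (exprAC _ j d) (prim_expr_order primd) expr1n.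
(* The shifts erased for one divisor embed into [I], so there are at most [e] of them, even if all
   erasures hit the same divisor. *)
- rewrite -cardI -(card_in_imset (f := fun k => (k, i))
    (D := [pred k | ~~ ((k, i) \notin I)])).
    apply: subset_leq_card; apply/subsetP => _ /imsetP[k + ->].
    by rewrite inE negbK.
  by move=> k l _ _ [].
rewrite size_frequencies // (leq_ltn_trans _ lt_e) //.
by rewrite leq_mul2l leq_totient_dvd ?orbT.
Qed.

End Ramanujan.

(** * Separation of the frequencies for steps 1 and 2 *)

Theorem theorem2p25 (R : realType) (N : nat) (N_gt0 : (0 < N)%N) :
  ((2 * totient N <= N - 1)%N ->
     robust_to_erasures 2 (ramanujan_system R 1 N)) /\
  (forall d : nat, N = (2 * d)%N -> odd d -> (2 * totient N <= d - 1)%N ->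
     robust_to_erasures 2 (ramanujan_system R 2 N)).
Proof.
split=> [le_phi|d defN odd_d le_phi].
  apply: ramanujan_system_robust; rewrite ?divn1 //; last lia.
  move=> j l /andP[j_gt0 lejN] /andP[l_gt0 lelN] _.
  (* Subtracting 1 moves the range 1..N to 0..N-1, where numbers are their own residues. *)
  rewrite -(subnK j_gt0) -(subnK l_gt0) => /eqP; rewrite eqn_modDr.
  by rewrite !modn_small ?subn1 ?prednK // => /eqP->.
have d_gt0 := odd_gt0 odd_d.
apply: ramanujan_system_robust;
  rewrite ?defN ?muln_gt0 ?dvdn_mulr // ?mulKn //; last first.
  by rewrite -defN; lia.
move=> j l jN lN eq_gcd eq_mod.
(* Since [N] is even, a number and its gcd with [N] have the same parity. *)
have odd_jl : odd j = odd l.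
  apply: negb_inj; rewrite -!dvdn2.
  have dvd2 i : (2 %| i)%N = (2 %| gcdn i (2 * d))%N.
    by rewrite dvdn_gcd dvdn_mulr ?andbT.
  by rewrite dvd2 eq_gcd -dvd2.
wlog lejl : j l jN lN eq_gcd eq_mod odd_jl / (j <= l)%N.
  move=> IH; case/orP: (leq_total j l) => ?; first exact: IH.
  by apply/esym/IH.
(* Equal parity and congruence modulo the odd [d] combine to congruence modulo [2 * d]; the range
   1..N then leaves only a zero difference. *)
have /dvdnP[k defk] : (2 * d %| l - j)%N.
  rewrite Gauss_dvd ?coprime2n // dvdn2 oddB // odd_jl addbb /=.
  by rewrite -eqn_mod_dvd // eq_mod.
case: k defk => [|k] defk; first lia.
have := leq_pmull (2 * d) (ltn0Sn k); lia.
Qed.
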